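(* Let $n\ge2$, $d=n-1$, $s\ge n$ and $\eta>0$. For Lebesgue-almost every $s$-tuple $\bm{\Theta}=(\bm{\theta}_1,\dots,\bm{\theta}_s)\in(\mathbb{R}^{d})^s$, the set $\mathfrak{F}(\bm{\Theta})\subset\mathbb{R}^n$ (a union of at most $ns$ lattices) is a dense forest whose visibility function satisfies $$v(\varepsilon)=O\left(\varepsilon^{-(n-1+\alpha_n(s)+\eta)}\right)\quad (\varepsilon\to0),\qquad \text{where } \alpha_n(s)=\frac{n(n-1)^2}{s-(n-1)}.$$
   Context: For $\bm{\Theta}=(\bm{\theta}_1,\dots,\bm{\theta}_s)$ with $\bm{\theta}_i\in\mathbb{R}^d$, $n=d+1$, define $\mathfrak{F}_1(\bm{\Theta})=\bigcup_{i=1}^s \begin{pmatrix}1&\bm{0}^T\\ \bm{\theta}_i& I_d\end{pmatrix}\mathbb{Z}^n$, where $I_d$ is the $d\times d$ identity. Let $J:\mathbb{R}^n\to\mathbb{R}^n$ be the linear map $J(x_1,x_2,\dots,x_n)^T=(x_2,x_3,\dots,x_n,x_1)^T$, and set $\mathfrak{F}(\bm{\Theta})=\bigcup_{\ell=1}^n J^{\ell-1}(\mathfrak{F}_1(\bm{\Theta}))$. A set $Y\subset\mathbb{R}^n$ is a dense forest with visibility function $v$ if for every $\varepsilon>0$ every line segment of length $v(\varepsilon)$ comes within distance $\varepsilon$ of $Y$ (any fixed norm; the implied constant may depend on $\bm{\Theta}$, $n$, $s$, $\eta$ and the norm). *)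

(* Defs.v *)
From HB Require Import structures.
From mathcomp Require Import all_boot all_order all_algebra.
From mathcomp Require Import all_classical all_reals all_analysis.

Set Implicit Arguments.
Unset Strict Implicit.
Unset Printing Implicit Defensive.
Import Order.TTheory GRing.Theory Num.Theory.
Import numFieldNormedType.Exports.

Local Open Scope classical_set_scope.
Local Open Scope ring_scope.

Definition cons_pair (T : Type) (n : nat) (p : T * n.-tuple T) : n.+1.-tuple T :=
  [tuple of p.1 :: p.2].

(* The n-fold product mu \x (mu \x (... \x mu)), transported to n.-tuple T;
   the 0-fold product is the unit mass on the one-point space. *)
Fixpoint power_measure (d : measure_display) (T : measurableType d)
    (R : realType) (mu : set T -> \bar R) (n : nat) {struct n} :
    set (n.-tuple T) -> \bar R :=
  match n with
  | 0 => \d_([tuple] : 0.-tuple T)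
  | m.+1 => pushforward (mu \x @power_measure d T R mu m)%E (@cons_pair T m)
  end.
Arguments power_measure {d T R} mu n.

(* Reproved because the library's sigma-finite instance on products is shadowed
   by its instance for products of probability measures. *)
Lemma sigma_finite_product_measure1 (d1 d2 : measure_display)
    (T1 : measurableType d1) (T2 : measurableType d2) (R : realType)
    (m1 : {sigma_finite_measure set T1 -> \bar R})
    (m2 : {sigma_finite_measure set T2 -> \bar R}) :
  sigma_finite setT (m1 \x m2)%E.
Proof.
have /sigma_finiteP[F [TF ndF Foo]] := sigma_finiteT m1.
have /sigma_finiteP[G [TG ndG Goo]] := sigma_finiteT m2.
exists (fun n => F n `*` G n).
  rewrite -setXTT TF TG predeqE => -[x y]; split.
    move=> [/= [n _ Fnx] [k _ Gky]]; exists (maxn n k) => //; split.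
    - by move: x Fnx; exact/subsetPset/ndF/leq_maxl.
    - by move: y Gky; exact/subsetPset/ndG/leq_maxr.
  by move=> [n _ []/= ? ?]; split; exists n.
move=> k; have [? ?] := Foo k; have [? ?] := Goo k.
split; first exact: measurableX.
by rewrite product_measure1E// lte_mul_pinfty// ge0_fin_numE.
Qed.

Section power_measure_sigma_finite.
Context (d : measure_display) (T : measurableType d) (R : realType).
Variable mu : {sigma_finite_measure set T -> \bar R}.

Lemma measurable_cons_pair n : measurable_fun setT (@cons_pair T n).
Proof. exact: measurable_cons. Qed.

Lemma power_measure_sigma_finite_measure n :
  {nu : {sigma_finite_measure set (n.-tuple T) -> \bar R} |
    nu = power_measure mu n :> (set (n.-tuple T) -> \bar R)}.
Proof.
elim: n => [|n [nu nuE]].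
  by exists (\d_([tuple] : 0.-tuple T)).
rewrite /= -nuE.
pose m : {measure set (n.+1.-tuple T) -> \bar R} :=
  measure_function_pushforward__canonical__measure_function_Measure
    (mu \x nu)%E (@measurable_cons_pair n).
suff sm : sigma_finite setT m.
  pose b := Measure_isSigmaFinite.Build _ _ _ m sm.
  by exists (HB.pack_for {sigma_finite_measure set (n.+1.-tuple T) -> \bar R}
    (m : set (n.+1.-tuple T) -> \bar R) (Measure.on m) b).
have [F TF Foo] := sigma_finite_product_measure1 mu nu.
pose g (t : n.+1.-tuple T) : T * n.-tuple T := (thead t, [tuple of behead t]).
have mg : measurable_fun setT g.
  apply/measurable_fun_pairP; split => /=.
    exact: measurable_tnth.
  exact: measurable_behead.
have fK : cancel (@cons_pair T n) g.
  by move=> [x t]; congr pair; exact/val_inj.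
exists (fun k => g @^-1` (F k)).
  by rewrite -preimage_bigcup -TF preimage_setT.
move=> k; have [mF Fk] := Foo k; split.
  by rewrite -[X in measurable X]setTI; exact: mg.
rewrite /m /= /pushforward -comp_preimage.
by rewrite (_ : g \o @cons_pair T n = id)//; exact/funext/fK.
Qed.

Let power_measure0 n : power_measure mu n set0 = 0%E.
Proof. by have [nu <-] := power_measure_sigma_finite_measure n. Qed.

Let power_measure_ge0 n A : (0 <= power_measure mu n A)%E.
Proof. by have [nu <-] := power_measure_sigma_finite_measure n. Qed.

Let power_measure_semi_sigma_additive n :
  semi_sigma_additive (power_measure mu n).
Proof.
have [nu <-] := power_measure_sigma_finite_measure n.
exact: measure_semi_sigma_additive.
Qed.

HB.instance Definition _ n := isMeasure.Build _ _ _ (power_measure mu n)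
  (power_measure0 n) (@power_measure_ge0 n)
  (@power_measure_semi_sigma_additive n).

Let power_measure_sigma_finite n : sigma_finite setT (power_measure mu n).
Proof.
by have [nu <-] := power_measure_sigma_finite_measure n; exact: sigma_finiteT.
Qed.

HB.instance Definition _ n := Measure_isSigmaFinite.Build _ _ _
  (power_measure mu n) (power_measure_sigma_finite n).

End power_measure_sigma_finite.

Definition lebesgue_measure_tuples (R : realType) (d s : nat) :
    set (s.-tuple (d.-tuple (measurableTypeR R))) -> \bar R :=
  power_measure (power_measure lebesgue_measure d) s.
Arguments lebesgue_measure_tuples : clear implicits.

HB.instance Definition _ (R : realType) (d s : nat) :=
  SigmaFiniteMeasure.on (lebesgue_measure_tuples R d s).

Section dense_forest.
Context (R : realType).

Definition is_norm (n : nat) (N : 'cV[R]_n -> R) : Prop :=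
  [/\ forall x, N x = 0 -> x = 0,
      forall a x, N (a *: x) = `|a| * N x &
      forall x y, N (x + y) <= N x + N y].

Definition segment (n : nat) (x y : 'cV[R]_n) : set 'cV[R]_n :=
  [set x + t *: (y - x) | t in `[0, 1]].

(* Nonnegativity of v is required because no segment has negative length. *)
Definition dense_forest (n : nat) (N : 'cV[R]_n -> R) (Y : set 'cV[R]_n)
    (v : R -> R) : Prop :=
  forall eps, 0 < eps ->
    0 <= v eps /\
    forall x y, N (y - x) = v eps ->
      exists p q, [/\ segment x y p, Y q & N (p - q) <= eps].

Definition mx_lattice (n : nat) (A : 'M[R]_n) : set 'cV[R]_n :=
  [set A *m map_mx intr z | z in [set: 'cV[int]_n]].

Definition is_lattice (n : nat) (L : set 'cV[R]_n) : Prop :=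
  exists2 A : 'M[R]_n, A \in unitmx & L = mx_lattice A.

Definition union_of_at_most_lattices (n m : nat) (Y : set 'cV[R]_n) : Prop :=
  exists (k : nat) (L : 'I_k -> set 'cV[R]_n),
    [/\ (k <= m)%N, forall i, is_lattice (L i) & Y = \bigcup_i L i].

Definition theta_mx (d : nat) (theta : d.-tuple R) : 'M[R]_d.+1 :=
  block_mx (1%:M : 'M[R]_1) 0 (\col_i tnth theta i) 1%:M.

Definition F1 (d s : nat) (Theta : s.-tuple (d.-tuple R)) : set 'cV[R]_d.+1 :=
  \bigcup_i mx_lattice (theta_mx (tnth Theta i)).

Definition J (n : nat) (x : 'cV[R]_n) : 'cV[R]_n := \col_i x (ordS i) 0.

(* l ranges over 0, ..., d, i.e. over the exponents l - 1 for 1 <= l <= n. *)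
Definition forest (d s : nat) (Theta : s.-tuple (d.-tuple R)) :
    set 'cV[R]_d.+1 :=
  \bigcup_(l in [set: 'I_d.+1]) iter l (@J d.+1) @` F1 Theta.

Definition alpha (n s : nat) : R :=
  n%:R * (n%:R - 1) ^+ 2 / (s%:R - (n%:R - 1)).

End dense_forest.

(* Main.v *)
Require Import Defs.
From HB Require Import structures.
From mathcomp Require Import all_boot all_order all_algebra.
From mathcomp Require Import all_classical all_reals all_analysis.
From mathcomp Require Import measurable_realfun perm complex ring lra zify.

(* A segment whose first coordinate varies most is [x + m (1, b)], up to
   reparametrization, with [b] in the unit cube: it comes close to the lattice
   of [theta_i] as soon as the orbit of [phi = theta_i - b] on the torus is
   dense.  By a quantitative Kronecker theorem (Fourier analysis with powers of
   the Fejer kernel), [m phi], [|m| <= V], is [1/q]-dense up to factors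
   [q^tau] as soon as [u . phi] stays at distance at least [delta ~ 1/V] from
   the integers for all integer vectors [0 < |u| <= k q].

   For fixed [b], a random [theta] violates this with probability
   [O(q^d delta)].  The condition is stable under moves of [b] of size
   [delta / q], so the probability that some [b] is bad for all of
   [theta_1, ..., theta_s] is [O((q / delta)^d (q^d delta)^s)].  Along
   [q = 2^j], [delta = q^-kappa], this is summable if
   [kappa (s - d) > d (s + 1)], which holds for [kappa > d + alpha_n(s)], and
   Borel-Cantelli concludes.  The other coordinates are handled by the
   rotations [J^l]. *)

Set Implicit Arguments.
Unset Strict Implicit.
Unset Printing Implicit Defensive.
Import Order.TTheory GRing.Theory Num.Theory.
Import numFieldNormedType.Exports.

Local Open Scope classical_set_scope.
Local Open Scope ring_scope.

(** * Quantitative Kronecker theorem *)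

Definition echar (R : realType) (x : R) : R[i] :=
  Complex (cos (pi *+ 2 * x)) (sin (pi *+ 2 * x)).

Lemma echarD (R : realType) (x y : R) : echar (x + y) = echar x * echar y.
Proof.
rewrite /echar mulrDr cosD sinD.
by apply/eqP; rewrite eq_complex /= eqxx /= addrC.
Qed.

Lemma echar0 (R : realType) : echar (0 : R) = 1.
Proof. by rewrite /echar mulr0 cos0 sin0. Qed.

Lemma norm_echar (R : realType) (x : R) : `|echar x| = 1.
Proof. by rewrite normc_def /= cos2Dsin2 sqrtr1. Qed.

Lemma echarN (R : realType) (x : R) : echar (- x) = (echar x)^*.
Proof. by rewrite /echar mulrN cosN sinN. Qed.

Lemma echar_sum (R : realType) (I : finType) (F : I -> R) :
  echar (\sum_i F i) = \prod_i echar (F i).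
Proof. exact: (big_morph _ (@echarD R) (@echar0 R)). Qed.

Lemma echarMn (R : realType) (x : R) n : echar (n%:R * x) = echar x ^+ n.
Proof.
elim: n => [|n IH]; first by rewrite mul0r echar0.
by rewrite -natr1 mulrDl mul1r echarD IH exprSr.
Qed.

Lemma echar1 (R : realType) : echar (1 : R) = 1.
Proof. by rewrite /echar mulr1 cos2pi sin2pi. Qed.

Lemma echar_int (R : realType) (z : int) : echar (z%:~R : R) = 1.
Proof.
have nat1 n : echar (n%:R : R) = 1 by rewrite -[n%:R]mulr1 echarMn echar1 expr1n.
by case: z => n; rewrite ?NegzE ?mulrNz ?echarN -?pmulrn nat1 ?rmorph1.
Qed.

(* Multiplying [x] by [n] so that [n x] lands in [1/4, 1/2], where the cosine
   is nonpositive, costs at most a factor [n] on [1 - echar x]. *)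
Lemma norm_1Bechar_ge (R : realType) (x : R) :
  0 < x <= 2^-1 -> (2 * x)%:C%C <= `|1 - echar x|.
Proof.
move=> /andP[x0 x2].
have step n : `|1 - echar (n%:R * x)| <= n%:R * `|1 - echar x|.
  rewrite echarMn -[X in X - _ ^+ _](expr1n _ n) subrXX normrM mulrC.
  apply: ler_wpM2r => //; apply: (le_trans (ler_norm_sum _ _ _)).
  rewrite -[leRHS]mulr1 -[n in leRHS]card_ord -sum1_card natr_sum mulr_suml.
  by apply: ler_sum => i _; rewrite expr1n !mul1r normrX norm_echar expr1n.
have far (y : R) : 4^-1 <= y <= 2^-1 -> 1 <= `|1 - echar y|.
  move=> /andP[y4 y2]; rewrite normc_def /= -[1 in leLHS]/(1%:C%C) lecR.
  have c0 : cos (pi *+ 2 * y) <= 0.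
    have -> : pi *+ 2 * y = (pi *+ 2 * y - pi) + pi :> R by ring.
    rewrite cosDpi oppr_le0; apply: cos_ge0_pihalf.
    have := @pi_gt0 R; move: (@pi R) => p p0; rewrite -mulr_natl.
    by apply/andP; split; nra.
  rewrite -[leLHS]sqrtr1 ler_sqrt; last first.
    by rewrite addr_ge0 ?sqr_ge0.
  have := cos2Dsin2 (pi *+ 2 * y); move: c0.
  move: (cos _) (sin _) => c t c0 e; have := sqr_ge0 c; nra.
(* The largest [n] with [n x <= 1/2]. As [n >= 1], maximality gives [n x > 1/2 - x >= 1/2 - n x],
   hence [n x >= 1/4]. *)
pose n := Num.truncn ((2 * x)^-1).
have i0 : 0 <= (2 * x)^-1 by rewrite invr_ge0; lra.
have /andP[nle] := truncn_itv i0; rewrite -/n -[n.+1%:R]natr1 => nlt.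
have n1 : (0 < n)%N.
  by rewrite truncn_gt0 -[leLHS]invr1 lef_pV2 ?posrE; lra.
have e1 : (2 * x)^-1 * (2 * x) = 1 by rewrite mulVf//; lra.
have n1R : (1 : R) <= n%:R by rewrite ler1n.
have nx : 4^-1 <= n%:R * x <= 2^-1 by apply/andP; split; nra.
have h := le_trans (far _ nx) (step n).
have n0C : (0 : R[i]) < n%:R by rewrite ltr0n.
rewrite -(ler_pM2l n0C); apply: le_trans h.
rewrite -(rmorph_nat (real_complex R)) -rmorphM/= -[1 in leRHS]/(1%:C%C) lecR.
nra.
Qed.

Lemma norm_1Bechar_ge_dist (R : realType) (delta x : R) :
  (forall z : int, delta <= `|x - z%:~R|) ->
  (2 * delta)%:C%C <= `|1 - echar x|.
Proof.
move=> dx; have [d0|d0] := leP delta 0.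
  by apply: le_trans (normr_ge0 _); rewrite -[0]/(0%:C%C) lecR; lra.
(* Subtracting the nearest integer brings [x] into [-1/2, 1/2); conjugation then removes the
   sign. *)
pose z := Num.floor (x + 2^-1); pose y := x - z%:~R.
have /andP[] := floor_itv (x + 2^-1); rewrite -/z intrD => z1 z2.
have {dx} := dx z; rewrite -/y => dy.
have -> : echar x = echar y.
  by rewrite -[x](subrK z%:~R) echarD echar_int mulr1.
have [y0|y0] := leP 0 y; move: dy; rewrite ?(ger0_norm y0) ?(ltr0_norm y0) => dy.
  apply: le_trans (norm_1Bechar_ge _); first by rewrite lecR; lra.
  rewrite /y in y0 dy *; lra.
have -> : `|1 - echar y| = `|1 - echar (- y)|.
  by rewrite -norm_conjC rmorphB rmorph1 echarN.
apply: le_trans (norm_1Bechar_ge _); first by rewrite lecR; lra.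
rewrite /y in y0 dy *; lra.
Qed.

(** [|dirichlet n x|^2] is [n] times the Fejer kernel; not centring the sum leaves moduli
    unchanged. *)
Definition dirichlet (R : realType) (n : nat) (x : R) : R[i] :=
  \sum_(j < n) echar (j%:R * x).

Lemma norm_dirichlet_le (R : realType) n (x : R) : `|dirichlet n x| <= n%:R.
Proof.
apply: (le_trans (ler_norm_sum _ _ _)).
under eq_bigr do rewrite norm_echar.
by rewrite sumr_const card_ord.
Qed.

(** The geometric sum telescopes: multiplied by [1 - echar x], of modulus at least [2 delta], it
    becomes [1 - echar x ^+ n], of modulus at most 2. *)
Lemma norm_dirichlet_le_dist (R : realType) n (delta x : R) : 0 < delta ->
  (forall z : int, delta <= `|x - z%:~R|) ->
  `|dirichlet n x| <= (delta^-1)%:C%C.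
Proof.
move=> d0 dx; have := norm_1Bechar_ge_dist dx => h.
have d2 : 0 < (2 * delta)%:C%C by rewrite -[0]/(0%:C%C) ltcR; lra.
rewrite -(ler_pM2l d2).
have -> : (2 * delta)%:C%C * (delta^-1)%:C%C = 2 :> R[i].
  rewrite -rmorphM/= -mulrA divff ?mulr1 ?gt_eqF//.
  by rewrite -(rmorph_nat (real_complex R)).
apply: (le_trans (ler_wpM2r _ h)) => //.
rewrite -normrM.
have -> : (1 - echar x) * dirichlet n x = 1 - echar x ^+ n.
  rewrite -[X in _ = X - _](expr1n _ n) subrXX; congr (_ * _).
  by apply: eq_bigr => i _; rewrite expr1n mul1r echarMn.
apply: (le_trans (ler_normB _ _)).
by rewrite normr1 normrX norm_echar expr1n.
Qed.

(** In the expansion of [|dirichlet q x|^2k], [p.1] chooses a term in each of the [k] plain factors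
    and [p.2] in each of the [k] conjugate ones; this is the frequency of their product. *)
Definition freq k q (p : {ffun 'I_k -> 'I_q} * {ffun 'I_k -> 'I_q}) : int :=
  \sum_i (p.1 i)%:Z - \sum_i (p.2 i)%:Z.

Lemma sum_Posz (I : finType) (F : I -> nat) :
  \sum_i (F i)%:Z = (\sum_i F i)%N.
Proof. by rewrite (big_morph Posz PoszD erefl). Qed.

Lemma freq_le k q (p : {ffun 'I_k -> 'I_q} * {ffun 'I_k -> 'I_q}) :
  (`|freq p| <= k * q)%N.
Proof.
have s (f : {ffun 'I_k -> 'I_q}) : (0 <= \sum_i (f i)%:Z <= (k * q)%:Z).
  rewrite sum_Posz !lez_nat /= -[k in (k * q)%N]card_ord -sum_nat_const.
  by apply: leq_sum => i _; exact: ltnW.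
have := s p.1; have := s p.2; rewrite /freq; lia.
Qed.

Lemma dirichlet_expansion (R : realType) k q (x : R) :
  `|dirichlet q x| ^+ (2 * k) =
  \sum_(p : {ffun 'I_k -> 'I_q} * {ffun 'I_k -> 'I_q}) echar ((freq p)%:~R * x).
Proof.
have e (t : R) : (\sum_(j < q) echar (j%:R * t)) ^+ k =
    \sum_(f : {ffun 'I_k -> 'I_q}) echar (\sum_i (f i)%:R * t).
  rewrite -[k in LHS]card_ord -prodr_const bigA_distr_bigA/=.
  by apply: eq_bigr => f _; rewrite echar_sum.
rewrite exprM normCK exprMn /dirichlet rmorph_sum/=.
under [X in _ * X ^+ k]eq_bigr do rewrite -echarN -mulrN.
rewrite !e big_distrlr/= pair_big/=; apply: eq_bigr => -[f g] _ /=.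
rewrite -echarD /freq /= intrD mulrNz mulrDl mulNr; congr (echar (_ + _)).
  by rewrite rmorph_sum/= mulr_suml.
by rewrite rmorph_sum/= mulr_suml -sumrN; apply: eq_bigr => i _; rewrite mulrN.
Qed.

(** Cauchy-Schwarz: if [r_v] counts the [f] of sum [v], the pairs of frequency 0 number
    [sum_v r_v^2], while the [r_v] add up to [q^k] over [k q] values of [v]. *)
Lemma card_freq0 k q : (0 < k)%N -> (0 < q)%N ->
  (q ^ (2 * k) <= k * q *
    #|[pred p : {ffun 'I_k -> 'I_q} * {ffun 'I_k -> 'I_q} | freq p == 0]|)%N.
Proof.
move=> k0 q0.
pose F := {ffun 'I_k -> 'I_q}.
have slt (f : F) : (\sum_i f i < k * q)%N.
  have -> : (k * q = \sum_(i < k) q)%N by rewrite sum_nat_const card_ord.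
  have : (\sum_(i < k) (f i).+1 <= \sum_(i < k) q)%N by apply: leq_sum.
  apply: leq_trans.
  rewrite -[X in (_ < X)%N]/(\sum_(i < k) (f i).+1)%N.
  under [X in (_ < X)%N]eq_bigr do rewrite -addn1.
  by rewrite big_split/= sum_nat_const card_ord muln1; lia.
pose S (f : F) : 'I_(k * q) := Ordinal (slt f).
pose r v := #|[pred f | S f == v]|.
have rE : (\sum_v r v = q ^ k)%N.
  have -> : (q ^ k = #|{: F}|)%N by rewrite card_ffun !card_ord.
  rewrite -sum1_card (partition_big S predT)//=.
  by apply: eq_bigr => v _; rewrite /r -sum1_card; apply: eq_bigl.
have cE : (#|[pred p : F * F | freq p == 0]| = \sum_v r v * r v)%N.
  rewrite -sum1_card (partition_big (fun p : F * F => S p.1) predT)//=.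
  apply: eq_bigr => v _; rewrite /r -cardX -sum1_card.
  apply: eq_bigl => -[f g]; rewrite !inE /= /freq /= subr_eq0.
  rewrite !sum_Posz eqz_nat -!val_eqE /=.
  case: (_ =P val v) => [->|]; rewrite ?andbF ?andbT//= eq_sym//.
rewrite mulnC cE mulnC expnM expnAC -rE.
(* After doubling, the inequality holds term by term over pairs: [2 r_v r_w <= r_v^2 + r_w^2]. *)
rewrite -(leq_pmul2l (isT : (0 < 2)%N)).
have -> : ((\sum_v r v) ^ 2 = \sum_(v < k * q) \sum_(w < k * q) r v * r w)%N.
  by rewrite -mulnn big_distrlr.
have -> : (2 * (k * q * \sum_v r v * r v) =
    \sum_(v < k * q) \sum_(w < k * q) (r v * r v + r w * r w))%N.
  under [RHS]eq_bigr do rewrite big_split/= sum_nat_const card_ord.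
  rewrite big_split/= sum_nat_const card_ord -big_distrr/=; lia.
rewrite big_distrr/=; apply: leq_sum => v _.
rewrite big_distrr/=; apply: leq_sum => w _.
by rewrite !mulnn; exact: nat_Cauchy.
Qed.

Definition diophantine (R : realType) (d Q : nat) (delta : R)
    (phi : 'I_d -> R) : Prop :=
  forall u : 'I_d -> int, (exists i, u i != 0) ->
    (forall i, `|u i| <= Q)%N -> forall z : int,
    delta <= `|\sum_i (u i)%:~R * phi i - z%:~R|.

(* Sum the nonnegative kernel [prod_i |dirichlet q (m phi_i - a_i)|^2k] over
   [m = freq mu]: its frequency-0 part dominates both the other frequencies,
   damped by the diophantine hypothesis, and the value it could reach if every
   orbit point stayed [eps]-away from [a]. *)
Lemma effective_kronecker (R : realType) (d k q M : nat) (delta eps : R)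
    (phi a : 'I_d -> R) :
  (0 < k)%N -> (0 < q)%N -> (0 < M)%N -> 0 < delta -> 0 < eps ->
  (k * q)%:R ^+ d *
    ((q%:R * eps) ^- (2 * k) + (M%:R * delta) ^- (2 * k)) < 1 ->
  diophantine (k * q) delta phi ->
  exists2 m : int, (`|m| <= k * M)%N &
    forall i, exists z : int, `|m%:~R * phi i - a i - z%:~R| < eps.
Proof.
move=> k0 q0 M0 dl0 eps0 small dioph.
have [//|noth] := pselect (exists2 m : int, (`|m| <= k * M)%N &
    forall i, exists z : int, `|m%:~R * phi i - a i - z%:~R| < eps).
exfalso.
have far m : (`|m| <= k * M)%N ->
    exists i, forall z : int, eps <= `|m%:~R * phi i - a i - z%:~R|.
  move=> mM; apply: contrapT => h; apply: noth; exists m => // i.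
  apply: contrapT => h2; apply: h; exists i => z.
  by rewrite leNgt; apply/negP => h3; apply: h2; exists z.
pose P n := ({ffun 'I_k -> 'I_n} * {ffun 'I_k -> 'I_n})%type.
pose T (mu : P M) : R[i] :=
  \prod_i `|dirichlet q ((freq mu)%:~R * phi i - a i)| ^+ (2 * k).
pose A : R := (q%:R * eps) ^- (2 * k).
pose B : R := (M%:R * delta) ^- (2 * k).
have qR : 0 < q%:R :> R by rewrite ltr0n.
have MR : 0 < M%:R :> R by rewrite ltr0n.
(* At each orbit point some coordinate is [eps]-far, and its factor is at most [eps^-2k]; the others
   get the trivial bound [q^2k]. So [A] is the gain over the trivial bound. *)
have TA mu : T mu <= ((q%:R ^+ (2 * k)) ^+ d * A)%:C%C.
  have [i hi] := far _ (freq_le mu).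
  have d1 : d = d.-1.+1 by case: (d) i {hi} => [[]|].
  rewrite /T (bigD1 i)//=.
  have -> : (q%:R ^+ (2 * k)) ^+ d * A =
      (eps^-1) ^+ (2 * k) * (q%:R ^+ (2 * k)) ^+ d.-1.
    rewrite [in LHS]d1 exprS /A exprMn exprVn.
    have : q%:R ^+ (2 * k) != 0 :> R by rewrite expf_neq0// gt_eqF.
    have : eps ^+ (2 * k) != 0 by rewrite expf_neq0// gt_eqF.
    move: (q%:R ^+ (2 * k)) (eps ^+ (2 * k)) => x y y0 x0.
    by move: (x ^+ d.-1) => z; field; rewrite x0 y0.
  rewrite rmorphM; apply: ler_pM.
  - by rewrite exprn_ge0.
  - by apply: prodr_ge0 => j _; rewrite exprn_ge0.
  - rewrite rmorphXn/=; apply: lerXn2r; rewrite ?nnegrE//.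
      by rewrite -[0]/(0%:C%C) lecR invr_ge0 ltW.
    exact: norm_dirichlet_le_dist.
  - have -> : d.-1 = #|predC1 i| by rewrite cardC1 card_ord.
    rewrite rmorphXn/= -prodr_const; apply: ler_prod => j _.
    rewrite exprn_ge0//= rmorphXn/= rmorph_nat.
    by apply: lerXn2r; rewrite ?nnegrE// norm_dirichlet_le.
(* The share of the frequency vector [u_i = freq (h i)]: summing [echar (m (u . phi))] over
   [m = freq mu] rebuilds a power of the Dirichlet kernel of length [M]. *)
pose W (h : {ffun 'I_d -> P q}) : R[i] :=
  echar (- \sum_i (freq (h i))%:~R * a i) *
  `|dirichlet M (\sum_i (freq (h i))%:~R * phi i)| ^+ (2 * k).
have TW : \sum_mu T mu = \sum_h W h.
  under eq_bigr => mu _.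
    rewrite /T; under eq_bigr do rewrite dirichlet_expansion.
    rewrite bigA_distr_bigA/=; over.
  rewrite exchange_big/=; apply: eq_bigr => h _.
  rewrite /W dirichlet_expansion mulr_sumr; apply: eq_bigr => mu _.
  rewrite -echar_sum -echarD; congr echar.
  rewrite mulr_sumr -sumrN -big_split/=; apply: eq_bigr => i _.
  ring.
pose Z := [pred p : P q | freq p == 0].
pose Zd (h : {ffun 'I_d -> P q}) := [forall i, h i \in Z].
have cardP n : #|{: P n}| = (n ^ (2 * k))%N.
  by rewrite card_prod card_ffun !card_ord mul2n -addnn expnD.
(* Main term: nothing oscillates, so each such [h] contributes the full [M^2k]. *)
have W0 : \sum_(h | Zd h) W h = (#|Z| ^ d * M ^ (2 * k))%N%:R.
  rewrite (eq_bigr (fun=> (M ^ (2 * k))%N%:R)); last first.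
    move=> h /forallP hZ.
    have h0 i : freq (h i) = 0 by have := hZ i; rewrite inE => /eqP.
    have sum0 (c : 'I_d -> R) : \sum_i (freq (h i))%:~R * c i = 0.
      by rewrite big1// => i _; rewrite h0 mul0r.
    rewrite /W !sum0.
    rewrite oppr0 echar0 mul1r /dirichlet.
    under eq_bigr do rewrite mulr0 echar0.
    by rewrite sumr_const card_ord ger0_norm// natrX.
  rewrite sumr_const natrM mulr_natl; congr (_ *+ _).
  have -> : #|[pred h | Zd h]| = #|ffun_on Z : pred {ffun 'I_d -> P q}|.
    by apply: eq_card => h; rewrite !inE.
  by rewrite card_ffun_on card_ord.
(* Here [u] is nonzero with entries at most [k q], so the diophantine hypothesis bounds the
   Dirichlet kernel by [1 / delta]. *)
have W1 : `|\sum_(h | ~~ Zd h) W h| <=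
    ((q%:R ^+ (2 * k)) ^+ d * (delta ^- (2 * k)))%:C%C.
  apply: (le_trans (ler_norm_sum _ _ _)).
  have bnd h : ~~ Zd h -> `|W h| <= (delta ^- (2 * k))%:C%C.
    rewrite negb_forall => /existsP[j]; rewrite inE => hj.
    rewrite normrM norm_echar mul1r normrX normr_id -exprVn rmorphXn/=.
    apply: lerXn2r; rewrite ?nnegrE//.
      by rewrite -[0]/(0%:C%C) lecR invr_ge0 ltW.
    apply: norm_dirichlet_le_dist => // z.
    apply: dioph; first by exists j.
    by move=> i; exact: freq_le.
  apply: (le_trans (ler_sum _ bnd)).
  rewrite sumr_const -[leLHS]mulr_natl rmorphM/=; apply: ler_wpM2r.
    by rewrite -[0]/(0%:C%C) lecR invr_ge0 exprn_ge0// ltW.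
  rewrite !rmorphXn/= rmorph_nat -!natrX ler_nat.
  by apply: (leq_trans (max_card _)); rewrite card_ffun cardP card_ord.
have T1 : \sum_mu T mu <= (M%:R ^+ (2 * k) * ((q%:R ^+ (2 * k)) ^+ d * A))%:C%C.
  apply: (le_trans (ler_sum _ (fun mu _ => TA mu))).
  rewrite sumr_const cardP -[leLHS]mulr_natl natrX [leRHS]rmorphM/=.
  by rewrite [X in _ <= X * _]rmorphXn/= rmorph_nat.
have T0 : 0 <= \sum_mu T mu.
  apply: sumr_ge0 => mu _; apply: prodr_ge0 => i _; exact: exprn_ge0.
have key : (#|Z| ^ d * M ^ (2 * k))%:R <=
    M%:R ^+ (2 * k) * ((q%:R ^+ (2 * k)) ^+ d * A) +
    (q%:R ^+ (2 * k)) ^+ d * (delta ^- (2 * k)) :> R.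
  rewrite -lecR rmorph_nat rmorphD/= -[leLHS]normr_nat -W0.
  have -> : \sum_(h | Zd h) W h = \sum_mu T mu - \sum_(h | ~~ Zd h) W h.
    by rewrite TW [X in _ = X - _](bigID Zd)/= addrK.
  apply: (le_trans (ler_normB _ _)); rewrite (ger0_norm T0).
  exact: lerD T1 W1.
(* The main term loses at most [(k q)^d] against the trivial count: this is the factor that [small]
   absorbs. *)
have Xle : (q%:R ^+ (2 * k)) ^+ d <= (k * q)%:R ^+ d * #|Z|%:R ^+ d :> R.
  rewrite -exprMn; apply: lerXn2r; rewrite ?nnegrE ?exprn_ge0//.
  by rewrite -natrX -natrM ler_nat; exact: card_freq0.
have X0 : 0 < (q%:R ^+ (2 * k)) ^+ d :> R by rewrite !exprn_gt0.
have Y0 : 0 < M%:R ^+ (2 * k) :> R by rewrite exprn_gt0.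
have BE : delta ^- (2 * k) = M%:R ^+ (2 * k) * B.
  by rewrite /B exprMn invfM mulrA divff ?mul1r// gt_eqF.
move: small; rewrite -/A -/B; apply/negP; rewrite -leNgt.
have K0 : 0 <= (k * q)%:R ^+ d :> R by rewrite exprn_ge0.
move: key; rewrite BE natrM !natrX => key.
rewrite -(ler_pM2l X0) mulr1; apply: (le_trans Xle).
rewrite mulrCA; apply: ler_wpM2l => //.
rewrite -(ler_pM2l Y0); move: key.
move: (M%:R ^+ (2 * k)) (_ ^+ d : R) (_ ^+ d : R) => y x z key; nra.
Qed.

(** * Almost every tuple is uniformly diophantine *)

Lemma measurable_all_tnth (disp : measure_display) (T : measurableType disp) n
    (E : set T) :
  measurable E -> measurable [set t : n.-tuple T | forall i, E (tnth t i)].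
Proof.
move=> mE.
have -> : [set t : n.-tuple T | forall i, E (tnth t i)] =
    \bigcap_(i in [set: 'I_n]) ((@tnth n T)^~ i @^-1` E).
  by apply/seteqP; split => t /= h i => [_|]; exact: h.
apply: fin_bigcap_measurable => // i _.
rewrite -[X in measurable X]setTI; exact: measurable_tnth.
Qed.

Lemma power_measure_all_tnth (disp : measure_display) (T : measurableType disp)
    (R : realType) (mu : {sigma_finite_measure set T -> \bar R}) n (E : set T) c :
  measurable E -> 0 <= c -> (mu E <= c%:E)%E ->
  (power_measure mu n [set t | forall i, E (tnth t i)] <= (c ^+ n)%:E)%E.
Proof.
move=> mE c0 Ec; elim: n => [|n IH] /=.
  by rewrite diracE expr0 lee_fin; case: (_ \in _).
rewrite /pushforward.
have -> : @cons_pair T n @^-1` [set t | forall i, E (tnth t i)] =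
    E `*` [set t | forall i, E (tnth t i)].
  apply/seteqP; split => [[x t]|[x t]] /=.
    move=> h; split; first by have := h ord0; rewrite (tnth_nth x).
    by move=> i; have := h (lift ord0 i); rewrite /cons_pair !(tnth_nth x).
  move=> [Ex Et] i; rewrite /cons_pair.
  case: (unliftP ord0 i) => [j|] ->; last by rewrite (tnth_nth x).
  by have := Et j; rewrite !(tnth_nth x).
rewrite product_measure1E//; last exact: measurable_all_tnth.
by rewrite exprS EFinM lee_pmul// measure_ge0.
Qed.

Lemma measure_fin_bigcup_le (disp : measure_display) (T : measurableType disp)
    (R : realType) (mu : {measure set T -> \bar R}) (I : finType)
    (F : I -> set T) c : (forall i, measurable (F i)) ->
  (forall i, mu (F i) <= c%:E)%E ->
  (mu (\bigcup_i F i) <= (#|I|%:R * c)%:E)%E.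
Proof.
move=> mF Fc.
have -> : \bigcup_i F i = \big[setU/set0]_(i <- enum I) F i.
  rewrite -bigcup_seq; apply: eq_bigcupl; split => i //= _.
  by rewrite mem_enum.
rewrite cardE; elim: (enum I) => [|i s IH].
  by rewrite big_nil measure0 mul0r.
rewrite big_cons /= -natr1 mulrDl mul1r addrC EFinD.
apply: le_trans (measureU2 _ _ _) _ => //.
  by apply: bigsetU_measurable.
by apply: leeD; [exact: Fc | exact: IH].
Qed.

(** At most [2 |u| L + 3] integers [z] occur, and each confines [x] to an interval of length
    [2 delta / |u|]; the factors [|u|] cancel, so the bound is uniform in [u]. *)
Lemma lebesgue_strip1_le (R : realType) (L : nat) (u : int) (c delta : R) :
  u != 0 -> 0 < delta <= 1 ->
  exists2 B : set (measurableTypeR R), measurable B /\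
    [set x | `|x| <= L%:R /\ exists z : int, `|u%:~R * x - c - z%:~R| < delta]
      `<=` B &
    (lebesgue_measure B <= ((2 * L + 3)%:R * (2 * delta))%:E)%E.
Proof.
move=> u0 /andP[d0 d1].
pose U : R := `|u%:~R|.
have U1 : 1 <= U by rewrite /U -intr_norm ler1z; lia.
(* All admissible [z] lie in [[z0, z0 + n)]: the tolerance [delta <= 1] costs 1 at each end and the
   rounding 1 more, whence the 3. *)
pose z0 := Num.floor (- c - U * L%:R - 1).
pose n := (2 * `|u| * L + 3)%N.
pose F (i : 'I_n) : set (measurableTypeR R) :=
  ball ((c + z0%:~R + i%:R) / u%:~R) (delta / U).
have uR : u%:~R != 0 :> R by rewrite intr_eq0.
exists (\bigcup_i F i).
  split.
    by apply: fin_bigcup_measurable => // i _; exact: measurable_ball.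
  move=> x [xL [z hz]].
  have ux : `|u%:~R * x| <= U * L%:R by rewrite normrM ler_pM.
  have /andP[z1 z2] := floor_itv (- c - U * L%:R - 1).
  rewrite -/z0 intrD in z1 z2.
  move: hz; rewrite ltr_norml => /andP[hz1 hz2].
  move: ux; rewrite ler_norml => /andP[ux1 ux2].
  have zz0 : z0 <= z by rewrite -(ler_int R); lra.
  have zn : (`|z - z0| < n)%N.
    rewrite -ltz_nat gez0_abs ?subr_ge0// -(ltr_int R).
    rewrite /n intrD PoszD intrD !PoszM !intrM -/U.
    have -> : (`|u|%N)%:~R = U :> R by rewrite /U -intr_norm.
    rewrite mulrNz; lra.
  exists (Ordinal zn) => //=; rewrite /F /= /ball/= distrC.
  have -> : (c + z0%:~R + `|z - z0|%:R) = c + z%:~R.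
    rewrite -[`|z - z0|%:R]/((`|z - z0|%N : int)%:~R).
    by rewrite gez0_abs ?subr_ge0// intrD mulrNz; ring.
  have -> : x - (c + z%:~R) / u%:~R = (u%:~R * x - c - z%:~R) / u%:~R.
    by field.
  rewrite normrM normfV -/U ltr_pM2r ?invr_gt0 ?(lt_le_trans ltr01)//.
  by rewrite ltr_norml hz1 hz2.
apply: (le_trans (measure_fin_bigcup_le (c := delta / U *+ 2) _ _)).
- by move=> i; exact: measurable_ball.
- move=> i.
  have r0 : 0 <= delta / U by rewrite divr_ge0 // ltW// (lt_le_trans ltr01).
  by rewrite -(lebesgue_measure_ball ((c + z0%:~R + i%:R) / u%:~R) r0).
have natr3 (x : nat) : (2 * x + 3)%:R = 2 * x%:R + 3 :> R by rewrite natrD natrM.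
rewrite card_ord lee_fin /n -mulnA !natr3 natrM.
have -> : (`|u|%N)%:R = U :> R.
  by rewrite -[LHS]/((`|u|%N : int)%:~R) /U -intr_norm.
have U0 : U != 0 by rewrite gt_eqF// (lt_le_trans ltr01).
have -> : (2 * (U * L%:R) + 3) * (delta / U *+ 2) =
  (2 * L%:R) * (2 * delta) + 3 * (2 * delta) / U by field.
have -> : (2 * L%:R + 3) * (2 * delta) =
  (2 * L%:R) * (2 * delta) + 3 * (2 * delta) by ring.
rewrite lerD2l ler_pdivrMr ?(lt_le_trans ltr01)//.
by rewrite ler_peMr//; lra.
Qed.

(** Tonelli: the measures of the sections are dominated by [c] times the indicator of [B]. *)
Lemma product_measure1_le (d1 d2 : measure_display) (T1 : measurableType d1)
    (T2 : measurableType d2) (R : realType)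
    (m1 : {measure set T1 -> \bar R})
    (m2 : {sigma_finite_measure set T2 -> \bar R})
    (A : set (T1 * T2)) (B : set T1) (a c : R) :
  measurable A -> measurable B -> 0 <= c -> (m1 B <= a%:E)%E ->
  (forall x y, A (x, y) -> B x) ->
  (forall x, B x -> (m2 (xsection A x) <= c%:E)%E) ->
  ((m1 \x m2) A <= (c * a)%:E)%E.
Proof.
move=> mA mB c0 Ba AB Bc; rewrite /product_measure1.
apply: (@le_trans _ _ (\int[m1]_x (c%:E * (\1_B x)%:E))%E).
  apply: ge0_le_integral => //=.
  - exact: measurable_fun_xsection.
  - apply: measurable_funeM; apply/measurable_EFinP.
    exact: measurable_indic.
  move=> x _; rewrite indicE.
  case: (boolP (x \in B)); rewrite ?inE ?notin_setE => xB.
    by rewrite mule1 Bc.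
  rewrite mule0 (_ : xsection A x = set0) ?measure0//.
  by apply/seteqP; split => y // /xsectionP /AB.
rewrite ge0_integralZl//=; last first.
  by apply/measurable_EFinP; exact: measurable_indic.
rewrite integral_indic// setIT EFinM.
by rewrite lee_wpmul2l.
Qed.

(** The [theta] in a box that are bad for one frequency vector [u]; [c] will be [u . b] for a
    direction [b]. *)
Definition strip (R : realType) (d L : nat) (u : 'I_d -> int) (c delta : R) :
    set (d.-tuple (measurableTypeR R)) :=
  [set t | (forall i, `|tnth t i| <= L%:R) /\
    exists z : int, `|\sum_i (u i)%:~R * tnth t i - c - z%:~R| < delta].

Lemma measurable_itv_norm (R : realType) (L : R) :
  measurable ([set x | `|x| <= L] : set (measurableTypeR R)).
Proof.
have -> : [set x | `|x| <= L] = `[- L, L]%classic :> set R.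
  by apply/seteqP; split => x /=; rewrite in_itv/= ler_norml.
exact: measurable_itv.
Qed.

Lemma lebesgue_itv_norm (R : realType) (L : nat) :
  lebesgue_measure ([set x | `|x| <= L%:R] : set (measurableTypeR R)) =
  (2 * L%:R)%:E.
Proof.
have -> : [set x | `|x| <= L%:R] = `[- L%:R, L%:R]%classic :> set R.
  by apply/seteqP; split => x /=; rewrite in_itv/= ler_norml.
rewrite lebesgue_measure_itv /= lte_fin.
case: ltP => [_|h]; first by rewrite -EFinB; congr EFin; ring.
have := ler0n R L => L0; have -> : L%:R = 0 :> R by lra.
by rewrite mulr0.
Qed.

Lemma measurable_strip (R : realType) (d L : nat) (u : 'I_d -> int)
    (c delta : R) : measurable (strip L u c delta).
Proof.
have -> : strip L u c delta =
    [set t : d.-tuple (measurableTypeR R) |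
      forall i, [set x | `|x| <= L%:R] (tnth t i)] `&`
    \bigcup_(z : int) ((fun t : d.-tuple (measurableTypeR R) =>
       \sum_i (u i)%:~R * tnth t i) @^-1` ball (c + z%:~R) delta).
  apply/seteqP; split => t /=.
    move=> [tL [z hz]]; split=> //; exists z => //=.
    by rewrite /ball/= distrC opprD addrA.
  move=> [tL [z _ /=]]; rewrite /ball/= distrC opprD addrA => hz.
  by split => //; exists z.
apply: measurableI.
  apply: measurable_all_tnth; exact: measurable_itv_norm.
apply: countable_bigcupT_measurable => // z.
rewrite -[X in measurable X]setTI.
apply: measurable_sum => // [i|]; last exact: measurable_ball.
apply: measurable_funM => //; exact: measurable_tnth.
Qed.

Lemma power_lebesgue_strip_le (R : realType) (d L : nat) (u : 'I_d -> int)
    (c delta : R) : (exists i, u i != 0) -> 0 < delta <= 1 ->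
  (power_measure lebesgue_measure d (strip L u c delta) <=
     ((2 * L + 3)%:R ^+ d * (2 * delta))%:E)%E.
Proof.
move=> u0 d01.
elim: d u c u0 => [|d IH] u c [i0 ui0]; first by case: i0 ui0.
have sumE x (t : d.-tuple R) : \sum_i (u i)%:~R * tnth (cons_pair (x, t)) i =
    (u ord0)%:~R * x + \sum_i (u (lift ord0 i))%:~R * tnth t i.
  rewrite big_ord_recl /cons_pair (tnth_nth x)/=; congr (_ + _).
  by apply: eq_bigr => i _; rewrite !(tnth_nth x).
have boxE x (t : d.-tuple R) :
    (forall i, `|tnth (cons_pair (x, t)) i| <= L%:R) ->
    `|x| <= L%:R /\ forall i, `|tnth t i| <= L%:R.
  move=> h; split; first by have := h ord0; rewrite (tnth_nth x).
  by move=> i; have := h (lift ord0 i); rewrite /cons_pair !(tnth_nth x).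
rewrite /= /pushforward; set A := _ @^-1` _.
have mA : measurable A.
  rewrite -[A]setTI; apply: measurable_cons_pair => //; exact: measurable_strip.
have K0 n : 0 <= (2 * L + 3)%:R ^+ n :> R by rewrite exprn_ge0.
have /andP[d0 d1] := d01.
(* If a later coefficient is nonzero, freeze [x], absorb its term into [c] and use induction on the
   section. *)
have [[i ui]|tail0] := pselect (exists i, u (lift ord0 i) != 0).
  apply: (le_trans (product_measure1_le mA (measurable_itv_norm L%:R)
    (c := (2 * L + 3)%:R ^+ d * (2 * delta)) (a := 2 * L%:R) _ _ _ _)).
  - by rewrite mulr_ge0//; lra.
  - by rewrite -lebesgue_itv_norm.
  - by move=> x t [/boxE[]].
  - move=> x /= xL.
    apply: le_trans (IH (fun i => u (lift ord0 i)) (c - (u ord0)%:~R * x) _);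
      last by exists i.
    apply: le_measure; rewrite ?inE.
    + exact: measurable_xsection.
    + exact: measurable_strip.
    move=> t /xsectionP [/boxE[_ tL] [z]]; rewrite sumE => hz.
    split => //; exists z; apply: le_lt_trans hz.
    by rewrite le_eqVlt; apply/orP; left; apply/eqP; congr `|_|; ring.
  rewrite lee_fin exprSr mulrAC; apply: ler_wpM2r; first lra.
  by apply: ler_wpM2l => //; rewrite natrD natrM; lra.
(* Otherwise the condition depends on [x] alone, and the other coordinates contribute the volume of
   a box. *)
have t0 i : u (lift ord0 i) = 0.
  by apply/eqP; apply: contrapT => h; apply: tail0; exists i; apply/negP.
have u00 : u ord0 != 0.
  by move: ui0; case: (unliftP ord0 i0) => [j|] ->//; rewrite t0 eqxx.
have [B [mB sB] leB] := lebesgue_strip1_le L c u00 d01.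
apply: (le_trans (product_measure1_le mA mB
    (c := (2 * L + 3)%:R ^+ d) _ leB _ _)) => //.
- move=> x t [/boxE[xL _] [z]]; rewrite sumE => hz; apply: sB; split => //.
  exists z; move: hz; rewrite big1 ?addr0// => i _; by rewrite t0 mul0r.
- move=> x _.
  apply: le_trans (power_measure_all_tnth _ (measurable_itv_norm L%:R) _ _) => //.
  + apply: le_measure; rewrite ?inE.
    * exact: measurable_xsection.
    * apply: measurable_all_tnth; exact: measurable_itv_norm.
    by move=> t /xsectionP [/boxE[_ tL] _].
  + apply: (@le_trans _ _ (2 * L%:R)%:E); first by rewrite -lebesgue_itv_norm.
    by rewrite lee_fin natrD natrM; lra.
by rewrite mulrA -exprSr.
Qed.

(** [(1, b)] is the direction of a segment. The index [i] may depend on [b], so [b] fails only if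
    all [s] independent vectors fail at once. *)
Definition uniformly_diophantine (R : realType) (d s Q : nat) (delta : R)
    (Theta : s.-tuple (d.-tuple R)) : Prop :=
  forall b : 'I_d -> R, (forall i, `|b i| <= 1) ->
    exists i, diophantine Q delta (fun l => tnth (tnth Theta i) l - b l).

(* Union bound over a [1/H]-net of the directions [b] and over the frequencies
   [u]; moving [b] to the net costs at most [d Q / H <= delta]. *)
Lemma not_uniformly_diophantine_cover (R : realType) (d s Q L H : nat)
    (delta : R) : 0 < delta -> 2 * delta <= 1 -> (0 < H)%N ->
  (d * Q)%:R <= H%:R * delta ->
  exists G : set (s.-tuple (d.-tuple (measurableTypeR R))),
  [/\ measurable G,
      forall Theta, (forall i l, `|tnth (tnth Theta i) l| <= L%:R) ->
        ~ uniformly_diophantine Q delta Theta -> G Theta &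
      (lebesgue_measure_tuples R d s G <=
       ((2 * H + 1)%:R ^+ d *
        ((2 * Q + 1)%:R ^+ d *
          ((2 * L + 3)%:R ^+ d * (2 * (2 * delta)))) ^+ s)%:E)%E].
Proof.
move=> d0 d1 H0 dQH.
(* A grid of mesh [1 / H] on [-1, 1]; next, the frequencies in [-Q, Q], shifted to start at 0. *)
pose net (g : {ffun 'I_d -> 'I_(2 * H + 1)}) l : R := (g l)%:R / H%:R - 1.
pose u (h : {ffun 'I_d -> 'I_(2 * Q + 1)}) l : int := (h l)%:Z - Q%:Z.
pose S g h : set (d.-tuple (measurableTypeR R)) :=
  if [exists l, u h l != 0] then
    strip L (u h) (\sum_l (u h l)%:~R * net g l) (2 * delta)
  else set0.
pose E g := \bigcup_h S g h.
have mS g h : measurable (S g h).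
  by rewrite /S; case: ifP => _; [exact: measurable_strip | exact: measurable0].
have mE g : measurable (E g) by apply: fin_bigcup_measurable.
exists (\bigcup_g [set Theta | forall i, E g (tnth Theta i)]); split.
- apply: fin_bigcup_measurable => // g _.
  exact: measurable_all_tnth.
- move=> Theta ThL /existsNP[b] /not_implyP[b1 /forallNP hb].
  have HR : 0 < H%:R :> R by rewrite ltr0n.
  have bl l : 0 <= (b l + 1) * H%:R <= (2 * H)%:R.
    have := b1 l; rewrite ler_norml natrM => /andP[? ?].
    by apply/andP; split; [apply: mulr_ge0|apply: ler_wpM2r]; lra.
  have glt l : (Num.truncn ((b l + 1) * H%:R) < 2 * H + 1)%N.
    have /andP[g0 g1] := bl l.
    by rewrite truncn_lt_nat// (le_lt_trans g1)// ltr_nat addn1.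
  pose g : {ffun 'I_d -> 'I_(2 * H + 1)} := [ffun l => Ordinal (glt l)].
  have netb l : `|b l - net g l| <= H%:R^-1.
    have /andP[g0 g1] := bl l.
    have /andP[t1 t2] := truncn_itv g0.
    rewrite /net ffunE /=; move: t1 t2; move: (Num.truncn _) => n.
    rewrite -[n.+1%:R]natr1 => t1 t2.
    have -> : b l - (n%:R / H%:R - 1) = ((b l + 1) * H%:R - n%:R) / H%:R.
      by field; rewrite gt_eqF.
    rewrite normrM normfV (gtr0_norm HR) ler_piMl ?invr_ge0 ?(ltW HR)//.
    by rewrite ler_norml; lra.
  exists g => // i /=.
  have /existsNP[v] := hb i.
  move=> /not_implyP[[l0 vl0]] /not_implyP[vQ] /existsNP[z] /negP.
  rewrite -ltNge => hz.
  have hlt l : (`|(v l + Q%:Z)%R| < 2 * Q + 1)%N by have := vQ l; lia.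
  pose h : {ffun 'I_d -> 'I_(2 * Q + 1)} := [ffun l => Ordinal (hlt l)].
  have uE l : u h l = v l.
    by rewrite /u ffunE /=; have := vQ l; lia.
  exists h => //; rewrite /S.
  case: ifPn => [_|]; last first.
    by rewrite negb_exists => /forallP /(_ l0); rewrite uE vl0.
  split; first exact: ThL.
  exists z.
  (* Moving [b] to the net adds an error of at most [delta], whence the half-width [2 delta] of the
     strips. *)
  have -> : \sum_l (u h l)%:~R * tnth (tnth Theta i) l -
      \sum_l (u h l)%:~R * net g l - z%:~R =
    (\sum_l (v l)%:~R * (tnth (tnth Theta i) l - b l) - z%:~R) +
    \sum_l (v l)%:~R * (b l - net g l).
    rewrite [RHS]addrAC; congr (_ - _).
    rewrite -sumrN -!big_split; apply: eq_bigr => l _ /=; rewrite uE; ring.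
  apply: le_lt_trans (ler_normD _ _) _.
  have -> : 2 * delta = delta + delta by ring.
  apply: ltr_leD => //.
  apply: (le_trans (ler_norm_sum _ _ _)).
  apply: (@le_trans _ _ (\sum_(l < d) Q%:R * H%:R^-1)).
    apply: ler_sum => l _; rewrite normrM ler_pM// -intr_norm.
    by rewrite -abszE -[leLHS]/((`|v l|%N)%:R) ler_nat.
  rewrite sumr_const card_ord -[leLHS]mulr_natl mulrA -natrM.
  by rewrite ler_pdivrMr// mulrC.
- have K0 n : 0 <= (2 * L + 3)%:R ^+ n :> R by rewrite exprn_ge0.
  apply: (le_trans (measure_fin_bigcup_le (c :=
    ((2 * Q + 1)%:R ^+ d *
      ((2 * L + 3)%:R ^+ d * (2 * (2 * delta)))) ^+ s) _ _)).
  + by move=> g; exact: measurable_all_tnth.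
  (* For a fixed net point the [s] conditions are independent, hence the power [s]. *)
  + move=> g; apply: power_measure_all_tnth => //.
      by rewrite mulr_ge0 ?exprn_ge0// mulr_ge0//; lra.
    apply: (le_trans (measure_fin_bigcup_le (c :=
      (2 * L + 3)%:R ^+ d * (2 * (2 * delta))) _ _)) => //.
      move=> h; rewrite /S; case: ifP => [/existsP uh|_].
        by apply: power_lebesgue_strip_le => //; apply/andP; split; lra.
      by rewrite measure0 lee_fin mulr_ge0//; lra.
    by rewrite card_ffun !card_ord natrX.
  by rewrite card_ffun !card_ord natrX.
Qed.

Lemma borel_cantelli_geometric (disp : measure_display)
    (T : measurableType disp) (R : realType) (mu : {measure set T -> \bar R})
    (F : (set T)^nat) (c r : R) :
  (forall j, measurable (F j)) -> 0 <= c -> 0 < r < 1 ->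
  (forall j, mu (F j) <= (c * r ^+ j)%:E)%E ->
  mu (lim_sup_set F) = 0%E.
Proof.
move=> mF c0 /andP[r0 r1] Fc; apply: lim_sup_set_cvg0 => //.
apply: (@le_lt_trans _ _ (c / (1 - r))%:E); last exact: ltry.
apply: lime_le; first by apply: is_cvg_nneseries.
apply: nearW => n.
apply: (@le_trans _ _ (series (geometric c r) n)%:E).
  rewrite /series /= -sumEFin.
  by apply: lee_sum => j _; exact: Fc.
by rewrite lee_fin geometric_le_lim// gtr0_norm.
Qed.

Lemma ae_uniformly_diophantine (R : realType) (d s k : nat) (kappa : R) :
  (0 < d)%N -> (d < s)%N -> (0 < k)%N ->
  (d * s.+1)%:R < kappa * (s%:R - d%:R) ->
  {ae lebesgue_measure_tuples R d s, forall Theta,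
    exists j0, forall j, (j0 <= j)%N ->
      uniformly_diophantine (k * 2 ^ j) ((2 `^ (- kappa)) ^+ j) Theta}.
Proof.
move=> d0 ds k0 hk; pose r : R := 2 `^ (- kappa).
have dsR : 0 < s%:R - d%:R :> R by rewrite subr_gt0 ltr_nat.
(* Holds because [d (s + 1) >= s - d]; it yields [2 r <= 1], hence [2 delta <= 1] at every scale
   used. *)
have kappa1 : 1 <= kappa.
  rewrite -(ler_pM2r dsR) mul1r; apply: le_trans (ltW hk).
  rewrite lerBlDr -natrD ler_nat; nia.
have r0 : 0 < r by rewrite powR_gt0.
have r2 : 2 * r <= 1.
  have : r <= 2 `^ (- 1) by rewrite ler_powR// ?lerN2// ler1n.
  by rewrite powR_inv1// => h; lra.
(* The factor gained by the failure bound [(q / delta)^d (q^d delta)^s] when [j] grows by 1. *)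
pose rho : R := (2 / r) ^+ d * (2 ^+ d * r) ^+ s.
have rho01 : 0 < rho < 1.
  rewrite /rho; apply/andP; split.
    by rewrite mulr_gt0// exprn_gt0// ?divr_gt0// mulr_gt0// exprn_gt0.
  have -> : (2 / r) ^+ d * (2 ^+ d * r) ^+ s =
      2 `^ ((d * s.+1)%:R - kappa * (s%:R - d%:R)).
    have p2 n : 2 ^+ n = 2 `^ n%:R :> R by rewrite powR_mulrn.
    have pr n : r ^+ n = 2 `^ (- kappa * n%:R).
      by rewrite /r powRrM powR_mulrn// powR_ge0.
    rewrite exprMn exprVn exprMn -exprM !p2 !pr -powRN -!powRD; last first.
    all: try by apply/implyP.
    by congr powR; rewrite !natrM -[s.+1%:R]natr1; ring.
  set e := (X in 2 `^ X); have e0 : e < 0 by rewrite /e; lra.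
  rewrite lt_neqAle powR_eq1 (lt_eqF e0) pnatr_eq1 ltrn0 /=.
  by rewrite -[leRHS](powRr0 2) ler_powR ?ler1n// ltW.
pose C (L : nat) : R := (6 * (d * k)%:R) ^+ d *
  ((3 * k%:R) ^+ d * ((2 * L + 3)%:R ^+ d * 4)) ^+ s * rho.
(* The scale is [j + 1] because [delta = 1] at scale 0 would violate [2 delta <= 1]. *)
have cover L j : exists G : set (s.-tuple (d.-tuple (measurableTypeR R))),
  [/\ measurable G,
      forall Theta, (forall i l, `|tnth (tnth Theta i) l| <= L%:R) ->
        ~ uniformly_diophantine (k * 2 ^ j.+1) (r ^+ j.+1) Theta -> G Theta &
      (lebesgue_measure_tuples R d s G <= (C L * rho ^+ j)%:E)%E].
  pose q : R := 2 ^+ j.+1; pose dl : R := r ^+ j.+1.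
  have q1 : 1 <= q by rewrite exprn_ege1// ler1n.
  have dl0 : 0 < dl by rewrite exprn_gt0.
  have dl2 : 2 * dl <= 1.
    have : r ^+ j <= 1 by rewrite exprn_ile1// ?ltW//; lra.
    by rewrite /dl exprS => h; nra.
  pose X : R := (d * k)%:R * q / dl.
  have dk1 : 1 <= (d * k)%:R :> R by rewrite ler1n muln_gt0 d0.
  have X1 : 1 <= X.
    by rewrite /X ler_pdivlMr// mul1r; nra.
  (* Fine enough for [d k q <= H delta], yet [O(q / delta)] since [X >= 1]. *)
  pose H := (Num.truncn X).+1.
  have X0 : 0 <= X by lra.
  have /andP[H1 H2] := truncn_itv X0.
  have [] := @not_uniformly_diophantine_cover R d s (k * 2 ^ j.+1) L H dl dl0
    dl2 isT.
    rewrite mulnA natrM natrX -/q; move: (ltW H2).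
    by rewrite /X ler_pdivrMr.
  move=> G [mG Gbad Gle]; exists G; split => //.
  apply: le_trans Gle _; rewrite lee_fin.
  have HX : (2 * H + 1)%:R <= 6 * (d * k)%:R * (q / dl).
    have -> : 6 * (d * k)%:R * (q / dl) = 6 * X by rewrite /X; ring.
    by rewrite natrD natrM /H -[_.+1%:R]natr1; lra.
  have QX : (2 * (k * 2 ^ j.+1) + 1)%:R <= 3 * k%:R * q.
    have : 1 <= k%:R * q.
      by rewrite mulr_ege1// ler1n.
    rewrite natrD natrM natrM natrX -/q; lra.
  have -> : C L * rho ^+ j = (6 * (d * k)%:R * (q / dl)) ^+ d *
      ((3 * k%:R * q) ^+ d * ((2 * L + 3)%:R ^+ d * (2 * (2 * dl)))) ^+ s.
    rewrite /C -mulrA -exprS.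
    have -> : rho ^+ j.+1 = (q / dl) ^+ d * (q ^+ d * dl) ^+ s.
      rewrite /rho [LHS]exprMn (exprAC _ d) (exprAC _ s) expr_div_n.
      by rewrite (exprMn _ (2 ^+ d)) (exprAC _ d).
    rewrite [in RHS](exprMn d _ (q / dl)) [in RHS](exprMn d _ q).
    move: (q / dl) (6 * _) => y1 y2.
    have -> : (3 * k%:R) ^+ d * q ^+ d * ((2 * L + 3)%:R ^+ d * (2 * (2 * dl))) =
      ((3 * k%:R) ^+ d * ((2 * L + 3)%:R ^+ d * 4)) * (q ^+ d * dl) by ring.
    by rewrite [in RHS](exprMn s _ (q ^+ d * dl)); ring.
  apply: ler_pM; rewrite ?exprn_ge0//.
  - by rewrite mulr_ge0 ?exprn_ge0// mulr_ge0 ?exprn_ge0//; lra.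
  - by apply: lerXn2r; rewrite ?nnegrE// (le_trans _ HX).
  apply: lerXn2r; rewrite ?nnegrE.
  - by rewrite mulr_ge0 ?exprn_ge0// mulr_ge0 ?exprn_ge0//; lra.
  - rewrite mulr_ge0 ?exprn_ge0// ?mulr_ge0 ?exprn_ge0//; lra.
  apply: ler_wpM2r; first by rewrite mulr_ge0 ?exprn_ge0//; lra.
  by apply: lerXn2r; rewrite ?nnegrE// (le_trans _ QX).
(* The whole space has infinite measure, so Borel-Cantelli is run in each box, and countably many
   boxes exhaust the space. *)
have bad L : (lebesgue_measure_tuples R d s).-negligible
  [set Theta : s.-tuple (d.-tuple (measurableTypeR R)) |
    (forall i l, `|tnth (tnth Theta i) l| <= L%:R) /\
    ~ exists j0, forall j, (j0 <= j)%N ->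
      uniformly_diophantine (k * 2 ^ j) (r ^+ j) Theta].
  have /choice[F hF] := cover L.
  have mF j : measurable (F j) by have [] := hF j.
  exists (lim_sup_set F); split.
  - apply: bigcap_measurable => [|j _]; first by exists 0%N.
    exact: bigcup_measurable.
  - apply: (@borel_cantelli_geometric _ _ _ _ _ (C L) rho) => //.
      have /andP[rho0 _] := rho01.
      apply: mulr_ge0 (ltW rho0); apply: mulr_ge0; apply: exprn_ge0.
        by rewrite mulr_ge0.
      by do !apply: mulr_ge0 => //; apply: exprn_ge0 => //; apply: mulr_ge0.
    by move=> j; have [] := hF j.
  move=> Theta /= [ThL nTh] n _.
  (* Asking for [n + 1] makes the bad scale positive, matching the shifted indexing of [F]. *)
  have [j nj hj] : exists2 j, (n.+1 <= j)%N &
      ~ uniformly_diophantine (k * 2 ^ j) (r ^+ j) Theta.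
    apply: contrapT => h; apply: nTh; exists n.+1 => j nj.
    by apply: contrapT => h2; apply: h; exists j.
  case: j nj hj => // j nj hj; exists j => //.
  by have [_ h _] := hF j; exact: h.
apply: negligibleS (negligible_bigcup bad) => Theta /= nTh.
pose M : R := \sum_i \sum_l `|tnth (tnth Theta i) l|.
exists (Num.truncn M).+1 => //; split => // i l.
apply: (@le_trans _ _ M); last by rewrite ltW// truncnS_gt.
rewrite /M (bigD1 i)//= (bigD1 l)//= -addrA lerDl addr_ge0//.
  by apply: sumr_ge0.
by apply: sumr_ge0 => j _; apply: sumr_ge0.
Qed.

(** * Visibility of the forest *)

Lemma J_mulmx (R : realType) n (x : 'cV[R]_n) :
  J x = perm_mx (perm (can_inj (@ordSK n))) *m x.
Proof. by rewrite -row_permE; apply/colP => i; rewrite !mxE permE. Qed.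

(** An invertible matrix maps lattices to lattices; this makes the rotated copies lattices. *)
Lemma iter_J_mulmx (R : realType) n l : exists2 P : 'M[R]_n, P \in unitmx &
  forall x, iter l (@J R n) x = P *m x.
Proof.
elim: l => [|l [P Pu IH]]; first by exists 1%:M => [|x]; rewrite ?unitmx1 ?mul1mx.
exists (perm_mx (perm (can_inj (@ordSK n))) *m P) => [|x].
  by rewrite unitmx_mul unitmx_perm.
by rewrite /= IH J_mulmx mulmxA.
Qed.

Lemma theta_mx_unit (R : realType) d (theta : d.-tuple R) :
  theta_mx theta \in unitmx.
Proof.
rewrite unitmxE /theta_mx.
by rewrite (@det_lblock _ 1 d 1%:M (\col_i tnth theta i) 1%:M) !det1 mulr1 unitr1.
Qed.

Lemma forest_union_of_lattices (R : realType) (d s : nat)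
    (Theta : s.-tuple (d.-tuple R)) :
  union_of_at_most_lattices (d.+1 * s) (forest Theta).
Proof.
pose L (p : 'I_d.+1 * 'I_s) :=
  iter p.1 (@J R d.+1) @` mx_lattice (theta_mx (tnth Theta p.2)).
exists #|{: 'I_d.+1 * 'I_s}|, (fun i => L (enum_val i)); split.
- by rewrite card_prod !card_ord.
- move=> i; rewrite /L; move: (enum_val i) => [l j] /=.
  have [P Pu PE] := @iter_J_mulmx R d.+1 l.
  exists (P *m theta_mx (tnth Theta j)); first by rewrite unitmx_mul Pu theta_mx_unit.
  apply/seteqP; split => [_ [_ [z _ <-] <-]|_ [z _ <-]].
    by exists z => //; rewrite PE mulmxA.
  exists (theta_mx (tnth Theta j) *m map_mx intr z); first by exists z.
  by rewrite PE mulmxA.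
- apply/seteqP; split => [_ [l _ [x [j _ xL] <-]]|x [i _]].
    exists (enum_rank (l, j)) => //; rewrite enum_rankK /L /=.
    by exists x.
  rewrite /L; move: (enum_val i) => [l j] /= [w wL <-].
  by exists l => //; exists w => //; exists j.
Qed.

Lemma iter_JE (R : realType) n l (x : 'cV[R]_n) i :
  iter l (@J R n) x i 0 = x (iter l (@ordS n) i) 0.
Proof. by elim: l i => // l IH i; rewrite [in RHS]iterSr -IH /= mxE. Qed.

Lemma val_iter_ordS n l (i : 'I_n) : iter l (@ordS n) i = ((i + l) %% n)%N :> nat.
Proof.
elim: l => [|l IH]; first by rewrite addn0 modn_small.
by rewrite /= IH -addn1 modnDml addn1 addnS.
Qed.

(** Cut at integer height [n] of the first coordinate: the lattice has the points [n theta_i] modulo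
    integers and the segment the point [x + (n - x_0) b]. They differ by [n phi] minus a constant, a
    Kronecker problem for [phi]. *)
Lemma F1_hits (R : realType) (d s k q M : nat) (delta eps : R)
    (Theta : s.-tuple (d.-tuple R)) (x y : 'cV[R]_d.+1) :
  (0 < k)%N -> (0 < q)%N -> (0 < M)%N -> 0 < delta -> 0 < eps ->
  (k * q)%:R ^+ d *
    ((q%:R * eps) ^- (2 * k) + (M%:R * delta) ^- (2 * k)) < 1 ->
  uniformly_diophantine (k * q) delta Theta ->
  (2 * (k * M) + 2)%:R <= `|y ord0 0 - x ord0 0| ->
  (forall i, `|y i 0 - x i 0| <= `|y ord0 0 - x ord0 0|) ->
  exists t w, [/\ 0 <= t <= 1, F1 Theta w &
    forall i, `|(x + t *: (y - x)) i 0 - w i 0| <= eps].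
Proof.
move=> k0 q0 M0 dl0 eps0 small dioph long dom.
pose D : R := y ord0 0 - x ord0 0.
have D0 : 0 < `|D| by apply: lt_le_trans long; rewrite ltr0n addn2.
have Dn0 : D != 0 by rewrite -normr_gt0.
pose b (l : 'I_d) : R := (y (lift ord0 l) 0 - x (lift ord0 l) 0) / D.
have b1 l : `|b l| <= 1.
  by rewrite /b normrM normfV ler_pdivrMr// mul1r.
have [i hi] := dioph b b1.
pose phi (l : 'I_d) : R := tnth (tnth Theta i) l - b l.
(* Starting from the midpoint keeps all heights [m0 + m], [|m| <= k M], on the segment; the 2 in
   [long] pays for the rounding. *)
pose m0 := Num.floor ((x ord0 0 + y ord0 0) / 2).
pose a (l : 'I_d) : R := x (lift ord0 l) 0 - x ord0 0 * b l - m0%:~R * phi l.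
have [m mM /choice[z hz]] :=
  effective_kronecker a k0 q0 M0 dl0 eps0 small hi.
pose n : R := (m0 + m)%:~R.
pose t : R := (n - x ord0 0) / D.
have tD : t * D = n - x ord0 0 by rewrite /t divfK.
pose w : 'cV[R]_d.+1 := theta_mx (tnth Theta i) *m
  map_mx intr (col_mx (const_mx (m0 + m) : 'cV[int]_1) (\col_l - z l)).
have wE : w = col_mx (const_mx n : 'cV[R]_1)
   (\col_l (tnth (tnth Theta i) l * n - (z l)%:~R)).
  pose U : 'cV[R]_1 := map_mx intr (const_mx (m0 + m)).
  pose V : 'cV[R]_d := map_mx intr (\col_l - z l).
  rewrite /w /theta_mx map_col_mx -/U -/V.
  transitivity (col_mx ((1%:M : 'M[R]_1) *m U + 0 *m V)
      ((\col_l tnth (tnth Theta i) l) *m U + 1%:M *m V)).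
    exact: (@mul_block_col R 1 d 1 d 1 1%:M 0 _ 1%:M U V).
  have -> : (1%:M : 'M[R]_1) *m U + 0 *m V = const_mx n.
    by rewrite mul1mx mul0mx addr0; apply/colP => j; rewrite !mxE.
  have -> : (\col_l tnth (tnth Theta i) l) *m U + 1%:M *m V =
      \col_l (tnth (tnth Theta i) l * n - (z l)%:~R).
    by rewrite mul1mx; apply/colP => j; rewrite !mxE big_ord1 !mxE mulrNz.
  by [].
have w0 : w ord0 0 = n.
  have e0 : ord0 = lshift d (ord0 : 'I_1) by apply/val_inj.
  by rewrite wE e0 (col_mxEu (const_mx n : 'cV[R]_1)) mxE.
exists t, w; split.
- have /andP[f1 f2] := floor_itv ((x ord0 0 + y ord0 0) / 2).
  rewrite -/m0 intrD in f1 f2.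
  have mR : `|m%:~R| <= (k * M)%:R :> R.
    by rewrite -intr_norm -abszE -[leLHS]/((`|m|%N)%:R) ler_nat.
  move: mR; rewrite ler_norml => /andP[m1 m2].
  have nE : n = m0%:~R + m%:~R by rewrite /n intrD.
  move: long; rewrite natrD natrM -/D; move: m1 m2.
  move: ((k * M)%:R : R) => K m1 m2 long.
  have DE : D = y ord0 0 - x ord0 0 by [].
  have [Dp|Dn] := ltP 0 D.
    rewrite gtr0_norm// in long.
    by rewrite /t divr_ge0 ?ler_pdivrMr ?mul1r ?(ltW Dp)//=; lra.
  rewrite ler0_norm// in long.
  have Dn' : 0 < - D by lra.
  have -> : t = (x ord0 0 - n) / (- D) by rewrite /t; field.
  by rewrite divr_ge0 ?ler_pdivrMr ?mul1r ?(ltW Dn')//=; lra.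
- by exists i => //; eexists; last reflexivity.
- move=> j; rewrite wE.
  case: (unliftP ord0 j) => [l|] ->.
    rewrite -(rshift1 l) (col_mxEd (const_mx n : 'cV[R]_1)) rshift1 !mxE.
    have tl : t * (y (lift ord0 l) 0 - x (lift ord0 l) 0) = (n - x ord0 0) * b l.
      by rewrite /t /b; ring.
    apply: ltW; apply: le_lt_trans (hz l).
    rewrite tl -[X in _ <= X]normrN le_eqVlt; apply/orP; left; apply/eqP.
    by congr `|_|; rewrite /a /phi /n intrD; ring.
  rewrite -wE w0 !mxE -/D tD.
  have -> : x ord0 0 + (n - x ord0 0) - n = 0 by ring.
  by rewrite normr0 ltW.
Qed.

(** [J^l] moves the dominant coordinate to the front and only permutes coordinates; the point found
    there is rotated back. *)
Lemma forest_hits (R : realType) (d s k q M : nat) (delta eps : R)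
    (Theta : s.-tuple (d.-tuple R)) (x y : 'cV[R]_d.+1) (l : 'I_d.+1) :
  (0 < k)%N -> (0 < q)%N -> (0 < M)%N -> 0 < delta -> 0 < eps ->
  (k * q)%:R ^+ d *
    ((q%:R * eps) ^- (2 * k) + (M%:R * delta) ^- (2 * k)) < 1 ->
  uniformly_diophantine (k * q) delta Theta ->
  (2 * (k * M) + 2)%:R <= `|y l 0 - x l 0| ->
  (forall i, `|y i 0 - x i 0| <= `|y l 0 - x l 0|) ->
  exists p w, [/\ segment x y p, forest Theta w &
    forall i, `|p i 0 - w i 0| <= eps].
Proof.
move=> k0 q0 M0 dl0 eps0 small dioph long dom.
have il : iter l (@ordS d.+1) ord0 = l.
  by apply/val_inj; rewrite /= val_iter_ordS add0n modn_small.
have [||t [w [t01 Fw hw]]] := @F1_hits R d s k q M delta eps Theta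
    (iter l (@J R d.+1) x) (iter l (@J R d.+1) y) k0 q0 M0 dl0 eps0 small dioph.
- by rewrite !iter_JE il.
- by move=> i; rewrite !iter_JE il.
(* [J^(d + 1 - l)] inverts [J^l]; the reduction matters for [l = 0], where [d + 1] is not an allowed
   exponent. *)
have l'lt : ((d.+1 - l) %% d.+1 < d.+1)%N by rewrite ltn_mod.
exists (x + t *: (y - x)), (iter (Ordinal l'lt) (@J R d.+1) w); split.
- by exists t => //; rewrite /= in_itv.
- by exists (Ordinal l'lt) => //; exists w.
move=> i; rewrite iter_JE.
have := hw (iter (Ordinal l'lt) (@ordS d.+1) i).
rewrite !mxE !iter_JE.
have -> : iter l (@ordS d.+1) (iter (Ordinal l'lt) (@ordS d.+1) i) = i.
  apply/val_inj; rewrite /= !val_iter_ordS /= modnDmr modnDml -addnA subnK.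
    by rewrite modnDr modn_small.
  by rewrite ltnW.
by [].
Qed.

(** Expand [w] in the standard basis; adding 1 keeps the constant positive even in dimension 0. *)
Lemma is_norm_le_sup (R : realType) n (N : 'cV[R]_n -> R) : is_norm N ->
  exists2 C : R, 0 < C & forall (w : 'cV[R]_n) r, 0 <= r ->
    (forall i, `|w i 0| <= r) -> N w <= C * r.
Proof.
move=> [_ NZ ND].
have N0 : N 0 = 0 by rewrite -(scale0r 0) NZ normr0 mul0r.
have Nge0 w : 0 <= N w.
  have := ND w (- w); rewrite subrr N0.
  by rewrite -[- w]scaleN1r NZ normrN1 mul1r; lra.
exists (1 + \sum_i N (delta_mx i 0)).
  by rewrite ltr_pwDl// sumr_ge0.
move=> w r r0 wr.
have {1}-> : w = \sum_i w i 0 *: delta_mx i 0.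
  rewrite [LHS]matrix_sum_delta; apply: eq_bigr => i _.
  by rewrite big_ord1.
apply: (@le_trans _ _ (\sum_i N (w i 0 *: delta_mx i 0))).
  elim/big_ind2 : _ => //; first by rewrite N0.
  by move=> u1 u2 v1 v2 h1 h2; apply: (le_trans (ND _ _)); rewrite lerD.
rewrite mulrDl mul1r mulr_suml -[leLHS]add0r lerD//.
by apply: ler_sum => i _; rewrite NZ mulrC ler_wpM2l.
Qed.

Lemma exists_pow2_between (R : realType) (x : R) : 1 <= x ->
  exists j, x <= 2 ^+ j <= 2 * x.
Proof.
move=> x1.
have ex : exists j, x <= 2 ^+ j.
  exists (Num.truncn x).+1; apply: (le_trans (ltW (truncnS_gt x))).
  by rewrite -natrX ler_nat ltnW// ltn_expl.
case: (ex_minnP ex) => -[|j] xj min; first by exists 0%N; rewrite xj expr0; lra.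
exists j.+1; rewrite xj /= exprS ler_pM2l// leNgt; apply/negP => h.
by have := min j (ltW h); rewrite ltnn.
Qed.

(* With [A = c q^tau], a diophantine exponent [kappa1] at scale [q] yields
   sup-distance [A / q] along segments of sup-length [O(q^(kappa1 + tau))]. *)
Lemma forest_hits_scale (R : realType) (d s k q : nat) (kappa1 tau : R)
    (Theta : s.-tuple (d.-tuple R)) (x y : 'cV[R]_d.+1) (l : 'I_d.+1) :
  (0 < k)%N -> (0 < q)%N -> 0 < kappa1 -> 0 < tau -> d%:R <= tau * (2 * k)%:R ->
  uniformly_diophantine (k * q) (q%:R `^ (- kappa1)) Theta ->
  let c : R := 2 * k%:R ^+ d + 1 in
  (4 * k%:R + 2) * c * q%:R `^ (kappa1 + tau) <= `|y l 0 - x l 0| ->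
  (forall i, `|y i 0 - x i 0| <= `|y l 0 - x l 0|) ->
  exists p w, [/\ segment x y p, forest Theta w &
    forall i, `|p i 0 - w i 0| <= c * q%:R `^ (tau - 1)].
Proof.
move=> k0 q0 kappa0 tau0 dtau dioph c long dom.
have q1 : 1 <= q%:R :> R by rewrite ler1n.
have qp : 0 < q%:R :> R by rewrite ltr0n.
have qn0 : q%:R != 0 :> R by rewrite gt_eqF.
have kd : 0 <= k%:R ^+ d :> R by rewrite exprn_ge0.
have c1 : 1 <= c by rewrite /c; lra.
pose A := c * q%:R `^ tau.
have qt1 : 1 <= q%:R `^ tau by rewrite -[leLHS](powRr0 q%:R) ler_powR// ltW.
have A1 : 1 <= A by rewrite /A mulr_ege1.
pose delta : R := q%:R `^ (- kappa1).
have delta0 : 0 < delta by rewrite powR_gt0.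
have delta1 : delta <= 1.
  by rewrite -[leRHS](powRr0 q%:R) ler_powR// oppr_le0 ltW.
have Ad1 : 1 <= A / delta by rewrite ler_pdivlMr// mul1r (le_trans delta1).
(* With [q eps = A] and [M delta > A], both error terms of the Kronecker theorem are at most
   [A^-2k]. *)
pose M := (Num.truncn (A / delta)).+1.
have Ad0 : 0 <= A / delta by rewrite (le_trans ler01).
have /andP[M1 M2] := truncn_itv Ad0.
pose eps : R := A / q%:R.
have epsE : eps = c * q%:R `^ (tau - 1).
  rewrite /eps /A powRD; last by rewrite qn0 implybT.
  by rewrite powR_inv1 ?ltW// mulrA.
rewrite -epsE; apply: (@forest_hits R d s k q M delta eps Theta x y l) => //.
- by rewrite divr_gt0// (lt_le_trans ltr01).
- have -> : q%:R * eps = A by rewrite /eps mulrC divfK.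
  have A0 : 0 < A by rewrite (lt_le_trans ltr01).
  (* [c^2k >= c > 2 k^d] absorbs the constant and [q^(2 k tau) >= q^d] the power of [q]. *)
  have A2k : 2 * (k * q)%:R ^+ d < A ^+ (2 * k).
    rewrite /A exprMn natrM exprMn mulrA.
    have cX : 2 * k%:R ^+ d < c ^+ (2 * k).
      apply: (@lt_le_trans _ _ c); first by rewrite /c; lra.
      by rewrite -[leLHS]expr1 ler_weXn2l// muln_gt0.
    have qX : q%:R ^+ d <= (q%:R `^ tau) ^+ (2 * k).
      rewrite -!powR_mulrn ?powR_ge0// -powRrM.
      by rewrite ler_powR.
    apply: (@le_lt_trans _ _ (2 * k%:R ^+ d * (q%:R `^ tau) ^+ (2 * k))).
      by rewrite ler_wpM2l// mulr_ge0.
    by rewrite ltr_pM2r// exprn_gt0// powR_gt0.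
  have MA : (M%:R * delta) ^- (2 * k) <= A ^- (2 * k).
    rewrite lef_pV2 ?posrE ?exprn_gt0// ?mulr_gt0 ?ltr0n//.
    apply: lerXn2r; rewrite ?nnegrE ?(ltW A0)//.
      by rewrite mulr_ge0// ltW.
    by rewrite -ler_pdivrMr// ltW.
  apply: (@le_lt_trans _ _ ((k * q)%:R ^+ d * (A ^- (2 * k) + A ^- (2 * k)))).
    by rewrite ler_wpM2l ?exprn_ge0// lerD2l.
  rewrite -[_ + _]mulr2n -[_ *+ 2]mulr_natl mulrA ltr_pdivrMr ?exprn_gt0//.
  by rewrite mul1r mulrC.
(* [A / delta >= 1] gives [M <= 2 A / delta], so [2 k M + 2 <= (4 k + 2) A / delta]. *)
- apply: le_trans long.
  have -> : (4 * k%:R + 2) * c * q%:R `^ (kappa1 + tau) =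
      (4 * k%:R + 2) * (A / delta).
    rewrite /delta powRN invrK powRD; last by rewrite qn0 implybT.
    by rewrite /A; ring.
  rewrite natrD natrM natrM /M -[_.+1%:R]natr1.
  have h1 := ler_wpM2l (ler0n R k) M1; have h2 := ler_wpM2l (ler0n R k) Ad1.
  lra.
Qed.

Theorem theorem1p4 (R : realType) (d s : nat) (eta : R)
    (N : 'cV[R]_d.+1 -> R)
    (hn : (2 <= d.+1)%N) (hs : (d.+1 <= s)%N) (heta : 0 < eta)
    (hN : is_norm N) :
  {ae lebesgue_measure_tuples R d s, forall Theta,
    union_of_at_most_lattices (d.+1 * s) (forest Theta) /\
    exists v : R -> R,
      dense_forest N (forest Theta) v /\
      v =O_ (0^'+)
        (fun eps => eps `^ (- (d.+1%:R - 1 + alpha R d.+1 s + eta)))}.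
Proof.
pose kappa : R := d.+1%:R - 1 + alpha R d.+1 s + eta.
(* One half of [eta] makes the summability condition strict, the other pays for the loss [q^tau]. *)
pose kappa1 : R := kappa - eta / 2.
have d1 : 1 <= d%:R :> R by rewrite ler1n.
have sd : 0 < s%:R - d%:R :> R by rewrite subr_gt0 ltr_nat.
have alphaE : alpha R d.+1 s * (s%:R - d%:R) = (d%:R + 1) * d%:R ^+ 2.
  rewrite /alpha -[d.+1%:R]natr1 addrK.
  by rewrite divfK// gt_eqF.
have alpha0 : 0 <= alpha R d.+1 s.
  by rewrite -(pmulr_lge0 _ sd) alphaE mulr_ge0 ?exprn_ge0//; lra.
have kappaE : kappa = d%:R + alpha R d.+1 s + eta.
  by rewrite /kappa -[d.+1%:R]natr1 addrK.
(* [d (s + 1) = d (s - d) + d^2 + d], and [alpha] contributes [d^3 + d^2 >= d^2 + d]. *)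
have kappa1_big : (d * s.+1)%:R < kappa1 * (s%:R - d%:R).
  rewrite /kappa1 kappaE natrM -[s.+1%:R]natr1.
  have -> : (d%:R + alpha R d.+1 s + eta - eta / 2) * (s%:R - d%:R) =
    d%:R * (s%:R - d%:R) + (d%:R + 1) * d%:R ^+ 2 + eta / 2 * (s%:R - d%:R).
    by rewrite -alphaE; field.
  have : 0 < eta / 2 * (s%:R - d%:R) by rewrite mulr_gt0// divr_gt0.
  have : d%:R <= d%:R ^+ 3 :> R by rewrite -[leLHS]expr1 ler_weXn2l.
  by rewrite !exprS expr0; nra.
have kappa0 : 0 < kappa by rewrite kappaE; lra.
have kappa10 : 0 < kappa1 by rewrite /kappa1 kappaE; lra.
(* Solves [(kappa1 + tau) / (1 - tau) = kappa]: length [q^(kappa1 + tau)] for distance [q^(tau - 1)]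
   then has exponent exactly [kappa]. *)
pose tau : R := (eta / 2) / (1 + kappa).
have tau0 : 0 < tau by rewrite divr_gt0//; lra.
have tau1 : tau < 1 by rewrite /tau ltr_pdivrMr kappaE; lra.
have tauE : kappa1 + tau = kappa * (1 - tau).
  by rewrite /kappa1 /tau; field; lra.
pose k := (Num.truncn (d%:R / tau)).+1.
have dk : d%:R <= tau * (2 * k)%:R.
  rewrite mulrC -ler_pdivrMr//; apply: (le_trans (ltW (truncnS_gt _))).
  by rewrite ler_nat leq_pmull.
have [C C0 NC] := is_norm_le_sup hN.
apply: negligibleS (ae_uniformly_diophantine (k := k) hn hs isT kappa1_big).
move=> Theta; apply: contra_not => -[j0 dioph].
split; first exact: forest_union_of_lattices.
pose c : R := 2 * k%:R ^+ d + 1.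
have c0 : 0 < c by rewrite /c ltr_pwDr// mulr_ge0// exprn_ge0.
have Cc0 : 0 < C * c by rewrite mulr_gt0.
(* For distances up to [eps0] the scale chosen below is at least [2^j0], where [dioph] applies. *)
pose eps0 : R := C * c / 2 ^+ j0.
have eps00 : 0 < eps0 by rewrite divr_gt0// exprn_gt0.
pose B : R := C * ((4 * k%:R + 2) * c * (2 `^ (kappa1 + tau) * (C * c) `^ kappa)).
have B0 : 0 <= B.
  rewrite /B mulr_ge0 ?(ltW C0)// mulr_ge0//; last by rewrite mulr_ge0// powR_ge0.
  by rewrite mulr_ge0 ?(ltW c0)//; have := ler0n R k; lra.
(* Beyond [eps0] the visibility is frozen; near 0 the minimum is [e], which gives the asymptotic
   bound. *)
exists (fun e => B * (Num.min e eps0) `^ (- kappa)); split; last first.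
  apply/eqOP; exists B; split => [|K BK]; first exact: num_real.
  near=> e.
  have e0 : 0 < e by near: e; exact: nbhs_right_gt.
  have ee : e <= eps0 by near: e; exact: nbhs_right_le.
  by rewrite min_l// normrM (ger0_norm B0) ler_wpM2r// ltW.
move=> e e0; pose e' := Num.min e eps0.
have e'0 : 0 < e' by rewrite lt_min e0.
split; first by rewrite mulr_ge0// powR_ge0.
move=> x y xy.
pose t := 1 - tau; have t0 : 0 < t by rewrite /t; lra.
(* The real scale with [C c X^(tau - 1) = e']; rounding it up to a power of 2 costs the factor
   [2^(kappa1 + tau)] in [B]. *)
pose X := (C * c / e') `^ t^-1.
have Xt : X `^ t = C * c / e'.
  by rewrite /X -powRrM mulVf ?gt_eqF// powRr1// divr_ge0 ?ltW.
have X0 : 0 <= X by rewrite powR_ge0.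
have XJ : 2 ^+ j0 <= X.
  have h : 2 ^+ j0 <= C * c / e'.
    rewrite ler_pdivlMr// mulrC -ler_pdivlMr ?exprn_gt0//.
    by rewrite ge_min lexx orbT.
  have h1 : 1 <= C * c / e' by apply: le_trans h; rewrite exprn_ege1// ler1n.
  apply: (le_trans h); rewrite /X -[leLHS]powRr1 ?(le_trans ler01)//.
  by rewrite ler_powR// invf_ge1// /t; lra.
have X1 : 1 <= X by apply: le_trans XJ; rewrite exprn_ege1// ler1n.
have [j /andP[Xj jX]] := exists_pow2_between X1.
have jj0 : (j0 <= j)%N.
  by have := le_trans XJ Xj; rewrite ler_eXn2l// ltr1n.
have q0 : (0 < 2 ^ j)%N by rewrite expn_gt0.
have dj := dioph j jj0.
have deltaE : (2 `^ (- kappa1)) ^+ j = (2 ^ j)%:R `^ (- kappa1) :> R.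
  by rewrite natrX -(@powR_mulrn R 2 j)// -(powR_mulrn j (powR_ge0 _ _)) powRAC.
rewrite deltaE in dj.
have [l _ lmax] := @arg_maxP _ _ 'I_d.+1 ord0 xpredT
  (fun i => `|y i 0 - x i 0|) isT.
have qE : (2 ^ j)%:R = 2 ^+ j :> R by rewrite natrX.
have [||p [w [sp Fw pw]]] := @forest_hits_scale R d s k (2 ^ j) kappa1 tau Theta
  x y l isT q0 kappa10 tau0 dk dj.
- have : N (y - x) <= C * `|y l 0 - x l 0|.
    by apply: NC => // i; rewrite !mxE; exact: lmax.
  have BE : B * e' `^ (- kappa) = C * ((4 * k%:R + 2) * c *
      (2 `^ (kappa1 + tau) * ((C * c) `^ kappa * e' `^ (- kappa)))).
    by rewrite /B !mulrA.
  rewrite xy -/e' BE ler_pM2l// => h; apply: le_trans h; apply: ler_wpM2l.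
    by rewrite mulr_ge0 ?(ltW c0)//; have := ler0n R k; lra.
  apply: (@le_trans _ _ ((2 * X) `^ (kappa1 + tau))).
    rewrite qE; apply: ge0_ler_powR => //; rewrite ?nnegrE ?exprn_ge0//.
      by rewrite addr_ge0// ltW.
    by rewrite mulr_ge0.
  rewrite powRM// ler_wpM2l ?powR_ge0// tauE -/t mulrC powRrM Xt.
  rewrite powRM ?invr_ge0 ?(ltW Cc0) ?(ltW e'0)//.
  by rewrite -(powR_inv1 (ltW e'0)) -powRrM mulN1r.
- by move=> i; exact: lmax.
exists p, w; split => //.
apply: (@le_trans _ _ e'); last by rewrite ge_min lexx.
apply: (le_trans (NC _ (c * (2 ^ j)%:R `^ (tau - 1)) _ _)).
- by rewrite mulr_ge0 ?powR_ge0// ltW.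
- by move=> i; rewrite !mxE; exact: pw.
rewrite mulrA -opprB powRN ler_pdivrMr ?powR_gt0 ?ltr0n//.
rewrite -ler_pdivrMl// [leLHS]mulrC -Xt qE; apply: ge0_ler_powR => //.
- exact: ltW.
- by rewrite nnegrE exprn_ge0.
Unshelve. all: by end_near.
Qed.
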